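(* The map $\mathbf g\mapsto \Xi(\mathbf g)$ from the group $G=S_\infty\times S_\infty\times S_\infty$ to the set of all equipped surfaces, considered up to combinatorial equivalence, is a bijection.
   Context: $S_\infty$ is the group of finitely supported permutations of $\mathbb N=\{1,2,\dots\}$. Elements of $G$ are written $\mathbf g=(g_{red},g_{yellow},g_{blue})$. Construction of $\Xi(\mathbf g)$: take a countable collection of identical oriented triangles, numbered by $\mathbb N$, whose sides are colored red, yellow, blue in clockwise order; these are called plus-triangles. Take another such collection, numbered by $\mathbb N$, whose sides are colored red, yellow, blue in anticlockwise order; these are called minus-triangles. For each color $\nu\in\{red,yellow,blue\}$ and each $k\in\mathbb N$, if $g_\nu k=l$, glue the $\nu$-colored side of the $k$-th plus-triangle with the $\nu$-colored side of the $l$-th minus-triangle, compatibly with the orientations. The result, with all signs, colors and numbers kept, is $\Xi(\mathbf g)$. ''Triangulated surface'' means a surface glued from triangles along sides, each edge being incident to exactly two triangles; each triangle is embedded injectively, but the intersection of two triangles is not required to be a single vertex or side. A ''double triangle'' is a sphere glued from two triangles along their whole perimeters. An equipped surface is a union (disjoint) of a countable family of oriented triangulated compact two-dimensional surfaces with the following additional structure: (i) each triangle is marked ''plus'' or ''minus'', and the marking is checkerwise (neighbors of plus-triangles are minus-triangles and vice versa); (ii) edges are colored red, yellow, blue so that the three sides of each triangle have distinct colors; the order red, yellow, blue is clockwise on plus-triangles and anticlockwise on minus-triangles; (iii) the plus-triangles are numbered (bijectively) by natural numbers, and so are the minus-triangles; (iv) all but finitely many connected components are double triangles whose plus-triangle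 and minus-triangle have the same number. Equipped surfaces are considered up to combinatorial equivalence, i.e. orientation-preserving isomorphisms of triangulated surfaces preserving signs, colors and numbers. *)

(* Defs.v *)
From Stdlib Require Import Relation_Operators.
From mathcomp Require Import all_boot.
From mathcomp Require Import boolp classical_sets functions cardinality.

Set Implicit Arguments.
Unset Strict Implicit.
Unset Printing Implicit Defensive.

Local Open Scope classical_set_scope.

(** * The group G *)

(* The natural numbers 1, 2, 3, ... *)
Definition posnat := {n : nat | (0 < n)%N}.

(* The inverse is part of the data, but it is determined by the permutation:
   see [Sinf_ext]. *)
Record Sinf := MkSinf {
  sfun :> posnat -> posnat;
  sinv : posnat -> posnat;
  sfunK : cancel sfun sinv;
  sinvK : cancel sinv sfun;
  sfun_supp : finite_set [set k | sfun k <> k]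
}.

Lemma Sinf_ext (p q : Sinf) : p =1 q -> p = q.
Proof.
case: p q => [f f' fK f'K ff] [g g' gK g'K fg] /= /funext E.
subst g; have E' : f' = g' by apply: funext => x; rewrite -[x in LHS]g'K fK.
by subst g'; congr MkSinf; apply: Prop_irrelevance.
Qed.

Variant color := Red | Yellow | Blue.
Variant sign := Plus | Minus.

Definition G := (Sinf * Sinf * Sinf)%type.

Definition at_color (g : G) (c : color) : Sinf :=
  match c with Red => g.1.1 | Yellow => g.1.2 | Blue => g.2 end.

(** * Oriented triangulated surfaces *)

(* Oriented triangles glued along their sides.  [face s] is the triangle of
   which [s] is a side, [next s] is the side that follows [s] when the
   perimeter of that triangle is traversed clockwise, and [glue s] is the side
   to which [s] is glued.

   Every side is directed by the clockwise traversal of its triangle.  As the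
   gluing is compatible with the orientations, [s] and [glue s] are identified
   with opposite directions: the origin of [s] is the end of [glue s]. *)
Record gluing := Gluing {
  tri : Type;
  side : Type;
  face : side -> tri;
  next : side -> side;
  glue : side -> side
}.

Section Surfaces.
Variable X : gluing.

(* The origin of [s], being the end of [glue s], is the origin of
   [next (glue s)].  These identifications generate all identifications of
   corners of triangles, so that the vertices of the surface are the classes of
   [same_origin]. *)
Definition same_origin : side X -> side X -> Prop :=
  clos_refl_sym_trans (side X) (fun s s' => s' = next (glue s)).

Definition neighbor (t t' : tri X) : Prop :=
  exists s : side X, face s = t /\ face (glue s) = t'.

Definition component (t : tri X) : set (tri X) :=
  [set t' | clos_refl_sym_trans (tri X) neighbor t t'].

Definition components : set (set (tri X)) := range component.

(* A disjoint union of countably many compact oriented triangulated surfaces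
   (without boundary). *)
Record triangulated_surface : Prop := TriangulatedSurface {
  (* each triangle has exactly three sides, cyclically permuted by [next] *)
  face_surj : forall t : tri X, exists s : side X, face s = t;
  face_next : forall s : side X, face (next s) = face s;
  next3 : forall s : side X, next (next (next s)) = s;
  next_neq : forall s : side X, next s <> s;
  face_sides : forall s s' : side X, face s' = face s ->
    s' = s \/ s' = next s \/ s' = next (next s);
  (* sides are glued in pairs, and each edge is incident to two triangles *)
  glueK : forall s : side X, glue (glue s) = s;
  face_glue : forall s : side X, face (glue s) <> face s;
  (* the three vertices of each triangle are distinct *)
  vertices_neq : forall s : side X, ~ same_origin s (next s);
  (* the components are compact, and there are countably many of them *)
  component_compact : forall C, components C -> finite_set C;
  components_countable : countable components
}.

(* The second clause says that the two perimeters are identified as wholes: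
   consecutive sides of [t] are glued to consecutive sides of [t'], which come
   in the opposite cyclic order.  Gluing three pairs of sides of two triangles
   in another way may produce a torus. *)
Definition double_triangle (t t' : tri X) : Prop :=
  [/\ t <> t',
      forall s : side X, face s = t ->
        face (glue s) = t' /\ next (glue (next s)) = glue s &
      component t = [set t; t']].

End Surfaces.

(** * Equipped surfaces *)

Definition next_color (c : color) : color :=
  match c with Red => Yellow | Yellow => Blue | Blue => Red end.

Definition prev_color (c : color) : color :=
  match c with Red => Blue | Yellow => Red | Blue => Yellow end.

Record decorated := Decorated {
  glued :> gluing;
  tri_sign : tri glued -> sign;
  side_color : side glued -> color;
  tri_num : tri glued -> posnat
}.

Definition standard_component (X : decorated) (C : set (tri X)) : Prop :=
  exists t t' : tri X,
    [/\ C = component t, double_triangle t t',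
        tri_sign t = Plus, tri_sign t' = Minus & tri_num t = tri_num t'].

Record equipped (X : decorated) : Prop := Equipped {
  equipped_surface : triangulated_surface X;
  checkerwise : forall s : side X,
    tri_sign (face (glue s)) <> tri_sign (face s);
  (* [side_color] is a coloring of edges *)
  color_glue : forall s : side X, side_color (glue s) = side_color s;
  color_inj : forall s s' : side X,
    face s = face s' -> side_color s = side_color s' -> s = s';
  color_plus : forall s : side X, tri_sign (face s) = Plus ->
    side_color (next s) = next_color (side_color s);
  color_minus : forall s : side X, tri_sign (face s) = Minus ->
    side_color (next s) = prev_color (side_color s);
  num_bij : forall (e : sign) (k : posnat),
    exists! t : tri X, tri_sign t = e /\ tri_num t = k;
  almost_standard :
    finite_set [set C | components C /\ ~ @standard_component X C]
}.

(* Commuting with [next] is preserving the orientation. *)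
Definition comb_equiv (X Y : decorated) : Prop :=
  exists (f : tri X -> tri Y) (h : side X -> side Y),
    (bijective f /\ bijective h) /\
    [/\ forall s, face (h s) = f (face s),
        forall s, next (h s) = h (next s) &
        forall s, glue (h s) = h (glue s)] /\
    [/\ forall t, tri_sign (f t) = tri_sign t,
        forall s, side_color (h s) = side_color s &
        forall t, tri_num (f t) = tri_num t].

Definition comb_class (X : decorated) : set decorated := [set Y | comb_equiv X Y].

(* The set of equipped surfaces up to combinatorial equivalence. *)
Definition equipped_classes : set (set decorated) := comb_class @` equipped.

(** * The surface Xi(g) *)

Definition Xi_next (s : sign * posnat * color) : sign * posnat * color :=
  match s with
  | (Plus, k, c) => (Plus, k, next_color c)
  | (Minus, l, c) => (Minus, l, prev_color c)
  end.

Definition Xi_glue (g : G) (s : sign * posnat * color) : sign * posnat * color :=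
  match s with
  | (Plus, k, c) => (Minus, at_color g c k, c)
  | (Minus, l, c) => (Plus, sinv (at_color g c) l, c)
  end.

Definition Xi_gluing (g : G) : gluing :=
  {| tri := sign * posnat;
     side := sign * posnat * color;
     face := fst;
     next := Xi_next;
     glue := Xi_glue g |}.

Definition Xi (g : G) : decorated :=
  {| glued := Xi_gluing g;
     tri_sign := fst;
     side_color := snd;
     tri_num := snd |}.

(* Main.v *)
From Stdlib Require Import Relation_Operators.
Require Import Defs.
From mathcomp Require Import all_boot.
From mathcomp Require Import boolp classical_sets functions cardinality.

(** A triangle of an equipped surface is determined by its sign and number, and
    a side by its triangle and color.  In these coordinates, signs, colors,
    numbers and the cyclic order of the sides of each triangle are the same for
    all equipped surfaces; only the gluing varies.  It exchanges signs and
    preserves colors, so it amounts to one bijection of the natural numbers for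
    each color, from the numbers of plus-triangles to those of minus-triangles.
    Hence an equipped surface is equivalent to
    the surface built from these three bijections
    ([equipped_comb_equiv_Xi]), and an equivalence between two such surfaces
    can only be the identity, so the bijections are recovered from the class
    ([Xi_comb_equiv_inj]).

    Finiteness of supports corresponds to the finiteness clauses on
    components.  A number fixed by all three permutations gives a double
    triangle with equal numbers; the other numbers form a finite
    set which each permutation preserves, and which therefore bounds both the
    number of non-standard components and their sizes
    ([Xi_equipped]).  Conversely, a number moved by some permutation is the
    number of a plus-triangle in a non-standard component, and there are
    finitely many of these, each of them finite.

    No triangle of the glued surface has two coinciding vertices:
    calling a vertex by the color of the opposite side is consistent with the
    gluing and separates the three vertices of each triangle
    ([Xi_same_origin]). *)

Set Implicit Arguments.
Unset Strict Implicit.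
Unset Printing Implicit Defensive.

Local Open Scope classical_set_scope.

(** * Combinatorial equivalence *)

Lemma comb_equiv_refl (X : decorated) : comb_equiv X X.
Proof. by exists id, id; split; [split; exists id | split; split]. Qed.

Lemma comb_equiv_sym (X Y : decorated) : comb_equiv X Y -> comb_equiv Y X.
Proof.
move=> [f [h [[[f' fK f'K] [h' hK h'K]] [[Hface Hnext Hglue] [Hsg Hcol Hnum]]]]].
exists f', h'; split; first by split; [exists f | exists h].
split; split.
- by move=> s; rewrite -{2}(h'K s) Hface fK.
- by move=> s; rewrite -{2}(h'K s) Hnext hK.
- by move=> s; rewrite -{2}(h'K s) Hglue hK.
- by move=> t; rewrite -{2}(f'K t) Hsg.
- by move=> s; rewrite -{2}(h'K s) Hcol.
- by move=> t; rewrite -{2}(f'K t) Hnum.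
Qed.

Lemma comb_equiv_trans (X Y Z : decorated) :
  comb_equiv X Y -> comb_equiv Y Z -> comb_equiv X Z.
Proof.
move=> [f [h [[fb hb] [[Hface Hnext Hglue] [Hsg Hcol Hnum]]]]].
move=> [f1 [h1 [[f1b h1b] [[Hface1 Hnext1 Hglue1] [Hsg1 Hcol1 Hnum1]]]]].
exists (f1 \o f), (h1 \o h); split; first by split; apply: bij_comp.
split; split => x /=.
- by rewrite Hface1 Hface.
- by rewrite Hnext1 Hnext.
- by rewrite Hglue1 Hglue.
- by rewrite Hsg1.
- by rewrite Hcol1.
- by rewrite Hnum1.
Qed.

Lemma comb_class_eq (X Y : decorated) :
  comb_equiv X Y -> comb_class X = comb_class Y.
Proof.
move=> XY; apply/seteqP; split => Z /=; apply: comb_equiv_trans => //.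
exact: comb_equiv_sym.
Qed.

(** * Colors and permutations *)

Lemma next_colorK : cancel next_color prev_color. Proof. by case. Qed.

Lemma G_ext (g g' : G) :
  (forall c k, at_color g c k = at_color g' c k) -> g = g'.
Proof.
move: g g' => [[r y] b] [[r' y'] b'] E; congr (_, _, _); apply: Sinf_ext.
- exact: (E Red).
- exact: (E Yellow).
- exact: (E Blue).
Qed.

Definition moved (g : G) : set posnat :=
  [set k | exists c, at_color g c k <> k].

Lemma finite_moved (g : G) : finite_set (moved g).
Proof.
have -> : moved g = [set k | at_color g Red k <> k] `|`
    [set k | at_color g Yellow k <> k] `|` [set k | at_color g Blue k <> k].
  apply/seteqP; split => k /= => [[[] H]|[[H|H]|H]]; first by left; left.
  - by left; right.
  - by right.
  - by exists Red.
  - by exists Yellow.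
  - by exists Blue.
by rewrite !finite_setU; split; [split|]; apply: sfun_supp.
Qed.

(** A permutation maps its own support to itself and fixes every other moved
    point, so the whole set of moved points is invariant under each color. *)
Lemma moved_at_color (g : G) (c : color) (k : posnat) :
  moved g (at_color g c k) <-> moved g k.
Proof.
case: (pselect (at_color g c k = k)) => [->//|neq].
split=> _; first by exists c.
by exists c => /(can_inj (@sfunK _)).
Qed.

Lemma not_movedP (g : G) (k : posnat) :
  ~ moved g k -> forall c, at_color g c k = k.
Proof. by move=> nm c; apply: contrapT => neq; apply: nm; exists c. Qed.

(** * The surface [Xi g] is equipped *)

Section XiSurface.
Variable g : G.

Lemma Xi_neighbor_moved (t t' : tri (Xi g)) : neighbor t t' ->
  (moved g t.2 <-> moved g t'.2) /\ (~ moved g t.2 -> t'.2 = t.2).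
Proof.
move=> [[[[] k] c] [<- <-]] /=.
  by rewrite moved_at_color; split=> // /not_movedP ->.
have <- := moved_at_color g c (sinv (at_color g c) k); rewrite sinvK.
by split=> // /not_movedP /(_ c) {1}<-; rewrite sfunK.
Qed.

Lemma Xi_component_moved (t t' : tri (Xi g)) : component t t' ->
  (moved g t.2 <-> moved g t'.2) /\ (~ moved g t.2 -> t'.2 = t.2).
Proof.
rewrite /component /=; elim=> {t t'}.
- exact: Xi_neighbor_moved.
- by [].
- by move=> x y _ [E eq]; split=> [|nm]; [rewrite E | rewrite eq ?E].
- move=> x y z _ [Exy xy] _ [Eyz yz]; split=> [|nm]; first by rewrite Exy.
  by rewrite yz ?xy // -Exy.
Qed.

Lemma Xi_component_fixed (e : sign) (k : posnat) : ~ moved g k ->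
  @component (Xi g) (e, k) = [set (Plus, k); (Minus, k)].
Proof.
move=> nm; have plus_minus : @neighbor (Xi g) (Plus, k) (Minus, k).
  by exists (Plus, k, Red); rewrite /= (not_movedP nm Red).
apply/seteqP; split=> [[e' k'] /Xi_component_moved [_ /(_ nm) /= ->]|].
  by case: e'; [left | right].
move=> _ [] ->; rewrite /component /=; case: e.
- exact: rst_refl.
- by apply: rst_sym; apply: rst_step.
- exact: rst_step.
- exact: rst_refl.
Qed.

Lemma Xi_standard_component (e : sign) (k : posnat) : ~ moved g k ->
  @standard_component (Xi g) (@component (Xi g) (e, k)).
Proof.
move=> nm; exists (Plus, k), (Minus, k); split=> //.
  by rewrite !Xi_component_fixed.
split=> //; last by rewrite Xi_component_fixed.
by move=> [[[] k'] c] //= [->]; rewrite !not_movedP // next_colorK.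
Qed.

Lemma Xi_component_finite (t : tri (Xi g)) : finite_set (component t).
Proof.
case: t => e k; case: (pselect (moved g k)) => [mk|nm]; last first.
  by rewrite Xi_component_fixed // finite_setU; split; apply: finite_set1.
apply: (@sub_finite_set _ _
  ((pair Plus @` moved g) `|` (pair Minus @` moved g))).
  move=> [e' k'] /Xi_component_moved /= [/iffLR /(_ mk) mk' _].
  by case: e'; [left | right]; exists k'.
by rewrite finite_setU; split; apply: finite_image; apply: finite_moved.
Qed.

Lemma Xi_components_countable : countable (@components (Xi g)).
Proof.
apply: (@sub_countable _ _ _ ((fun p : bool * posnat =>
  @component (Xi g) (if p.1 then Plus else Minus, p.2)) @` setT)).
  apply: subset_card_le => _ [[e k] _ <-].
  by case: e; [exists (true, k) | exists (false, k)].
by apply: card_le_trans (card_image_le _ _) _; apply: countableP.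
Qed.

(** The color of the side opposite to the origin of a side.  That vertex lies
    between the side and its predecessor on the perimeter, whose color is the
    previous one on plus-triangles and the next one on minus-triangles. *)
Definition opposite_color (s : side (Xi g)) : color :=
  match s.1.1 with
  | Plus => next_color s.2
  | Minus => prev_color s.2
  end.

Lemma Xi_same_origin (s s' : side (Xi g)) :
  same_origin s s' -> opposite_color s = opposite_color s'.
Proof.
elim=> {s s'} [s _ -> | // | // | ? ? ? _ -> _ ->] //.
by case: s => [[[] k] []].
Qed.

Lemma Xi_triangulated_surface : triangulated_surface (Xi g).
Proof.
split.
- by move=> t; exists (t, Red).
- by move=> [[[] k] c].
- by move=> [[[] k] []].
- by move=> [[[] k] []].
- by move=> [[[] k] c] [t c'] /= ->; case: c c' => [] []; tauto.
- by move=> [[[] k] c] /=; rewrite ?sfunK ?sinvK.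
- by move=> [[[] k] c].
- by move=> s /Xi_same_origin; case: s => [[[] k] []].
- by move=> _ [t _ <-]; apply: Xi_component_finite.
- exact: Xi_components_countable.
Qed.

Lemma Xi_equipped : equipped (Xi g).
Proof.
split.
- exact: Xi_triangulated_surface.
- by move=> [[[] k] c].
- by move=> [[[] k] c].
- by move=> [t c] [t' c'] /= -> ->.
- by move=> [[[] k] c].
- by move=> [[[] k] c].
- by move=> e k; exists (e, k); split=> // -[e' k'] /= [-> ->].
- apply: (@sub_finite_set _ _
    (((fun k => @component (Xi g) (Plus, k)) @` moved g) `|`
     ((fun k => @component (Xi g) (Minus, k)) @` moved g))).
    move=> _ [[[e k] _ <-] nstd].
    have mk : moved g k.
      by apply: contrapT => nm; apply: nstd; apply: Xi_standard_component.
    by case: e {nstd}; [left | right]; exists k.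
  by rewrite finite_setU; split; apply: finite_image; apply: finite_moved.
Qed.

End XiSurface.

(** An equivalence preserves signs, numbers and colors, which are the
    coordinates of the sides of [Xi g]; so it is the identity, and the two
    gluings coincide. *)
Lemma Xi_comb_equiv_inj (g g' : G) : comb_equiv (Xi g) (Xi g') -> g = g'.
Proof.
move=> [f [h [_ [[Hface _ Hglue] [Hsg Hcol Hnum]]]]].
have f_id t : f t = t.
  by case: t (Hsg t) (Hnum t) => e k /=; case: (f _) => e' k' /= -> ->.
have h_id s : h s = s.
  case: s (Hface s) (Hcol s) => t c /=; case: (h _) => t' c' /= ->.
  by rewrite f_id => ->.
apply: G_ext => c k.
by have := Hglue (Plus, k, c); rewrite !h_id => -[].
Qed.

(** * Coordinates on an equipped surface *)

Section Coordinates.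
Variable X : decorated.
Hypothesis eqX : equipped X.

Definition tri_coord (t : tri X) : sign * posnat := (tri_sign t, tri_num t).

Definition side_coord (s : side X) : sign * posnat * color :=
  (tri_coord (face s), side_color s).

Let eqS := equipped_surface eqX.

Lemma tri_coord_inj : injective tri_coord.
Proof.
move=> t t' [Es En].
have [u [_ uniq_u]] := num_bij eqX (tri_sign t) (tri_num t).
by rewrite -(uniq_u t) // -(uniq_u t').
Qed.

Lemma tri_coord_surj (p : sign * posnat) : exists t, tri_coord t = p.
Proof.
by case: p => e k; have [t [[<- <-] _]] := num_bij eqX e k; exists t.
Qed.

Lemma side_coord_inj : injective side_coord.
Proof.
by move=> s s' [Es En Ec]; apply: (color_inj eqX) => //; apply: tri_coord_inj;
  rewrite /tri_coord Es En.
Qed.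

Lemma side_coord_next (s : side X) :
  side_coord (Defs.next s) = Xi_next (side_coord s).
Proof.
rewrite /side_coord /tri_coord (face_next eqS).
case Es: (tri_sign (face s)) => /=; first by rewrite (color_plus eqX Es).
by rewrite (color_minus eqX Es).
Qed.

(** The three sides of a triangle carry all three colors, since the color
    changes cyclically along the perimeter. *)
Lemma side_coord_surj (p : sign * posnat * color) : exists s, side_coord s = p.
Proof.
case: p => q c; have [t tq] := tri_coord_surj q.
have [s st] := face_surj eqS t.
have Es : side_coord s = (q, side_color s) by rewrite /side_coord st tq.
have Es1 := side_coord_next s; have Es2 := side_coord_next (Defs.next s).
rewrite Es1 Es in Es2; rewrite Es in Es1.
case: q {tq} Es Es1 Es2 => [[] k]; case: (side_color s) => /= E E1 E2; case: c;
  by [exists s | exists (Defs.next s) | exists (Defs.next (Defs.next s))].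
Qed.

Lemma tri_coord_bij : bijective tri_coord.
Proof.
have [r rK] := choice tri_coord_surj.
by exists r => // t; apply: tri_coord_inj; rewrite rK.
Qed.

Lemma side_coord_bij : bijective side_coord.
Proof.
have [r rK] := choice side_coord_surj.
by exists r => // s; apply: side_coord_inj; rewrite rK.
Qed.

(** A standard component has a single plus-triangle, glued along its three
    sides to the minus-triangle with the same number. *)
Lemma standard_component_glue (s : side X) :
    tri_sign (face s) = Plus ->
    @standard_component X (component (face s)) ->
  tri_num (face (Defs.glue s)) = tri_num (face s).
Proof.
move=> s_plus [t [t' [Cs [_ glue_tt' Ct] t_plus t'_minus num_tt']]].
have : component (face s) (face s) by apply: rst_refl.
rewrite Cs Ct => -[st|st']; last by rewrite st' t'_minus in s_plus.
by have [-> _] := glue_tt' s st; rewrite st.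
Qed.

(** Non-standard components are finitely many and compact, so together they
    have finitely many triangles. *)
Lemma finite_num_glue_neq : finite_set [set k | exists2 s : side X,
  tri_coord (face s) = (Plus, k) & tri_num (face (Defs.glue s)) <> k].
Proof.
apply: (@sub_finite_set _ _ ((@tri_num X) @`
  \bigcup_(C in [set C | components C /\ ~ @standard_component X C]) C)).
  move=> k [s [s_plus sk] neq]; exists (face s) => //.
  exists (component (face s)); last exact: rst_refl.
  split; first by exists (face s).
  by move=> /(standard_component_glue s_plus); rewrite sk.
apply: finite_image; apply: bigcup_finite; first exact: (almost_standard eqX).
by move=> C [/(component_compact eqS)].
Qed.

(** In coordinates, the gluing is an involution exchanging signs and preserving
    colors; its restriction to the plus-sides of each color is one of the three
    permutations, and its restriction to the minus-sides is the inverse. *)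
Lemma equipped_comb_equiv_Xi : exists g : G, comb_equiv X (Xi g).
Proof.
have [r sK rK] := side_coord_bij.
pose num_across e c k := tri_num (face (Defs.glue (r (e, k, c)))).
pose opp e := match e with Plus => Minus | Minus => Plus end.
have glueE e c k :
    side_coord (Defs.glue (r (e, k, c))) = (opp e, num_across e c k, c).
  have [sgn _ col] := rK (e, k, c).
  rewrite /side_coord /tri_coord (color_glue eqX) col.
  have := @checkerwise _ eqX (r (e, k, c)); rewrite sgn => neq.
  by congr (_, _, _); case: (tri_sign _) neq; case: e {sgn col}.
have num_acrossK e c : cancel (num_across e c) (num_across (opp e) c).
  move=> k; rewrite {1}/num_across -glueE sK (glueK eqS).
  by have [_ ->] := rK (e, k, c).
have supp c : finite_set [set k | num_across Plus c k <> k].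
  apply: sub_finite_set finite_num_glue_neq => k neq.
  have [sgn num _] := rK (Plus, k, c).
  by exists (r (Plus, k, c)); rewrite // /tri_coord sgn num.
pose p c := MkSinf (num_acrossK Plus c) (num_acrossK Minus c) (supp c).
pose g : G := (p Red, p Yellow, p Blue).
have gE c : at_color g c = p c by case: c.
exists g, tri_coord, side_coord; split.
  by split; [exact: tri_coord_bij | exact: side_coord_bij].
split; split=> // s; first by rewrite side_coord_next.
rewrite -(sK s); case: (side_coord s) => [[e k] c].
by rewrite glueE rK; case: e; rewrite /= gE.
Qed.

End Coordinates.

Theorem theorem3p3 :
  set_bij [set: G] equipped_classes (fun g : G => comb_class (Xi g)).
Proof.
split.
- by move=> g _; exists (Xi g) => //; apply: Xi_equipped.
- move=> g g' _ _ E; apply: Xi_comb_equiv_inj.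
  have : comb_class (Xi g') (Xi g') by apply: comb_equiv_refl.
  by rewrite -E.
- move=> _ [X eqX <-]; have [g Xg] := equipped_comb_equiv_Xi eqX.
  by exists g => //; apply/esym/comb_class_eq.
Qed.
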